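(* Let $(\mathfrak{g},[\cdot,\cdot],\alpha)$ be a regular hom-Lie algebra and $r\in\mathcal{H}^2$ a skew-symmetric $r$-matrix on $(\mathfrak{g},[\cdot,\cdot],\alpha)$. Then: (1) An element $\tau\in\mathcal{H}^2$ generates a linear deformation of $r$ if and only if the induced map $\tau^\sharp:\mathfrak{g}^*\to\mathfrak{g}$ generates a linear deformation of the $\mathcal{O}$-operator $r^\sharp$. (2) Linear deformations $r^1_t:=r+t\tau_1$ and $r^2_t:=r+t\tau_2$ of $r$ are equivalent if and only if the linear deformations $(r^1_t)^\sharp$ and $(r^2_t)^\sharp$ of the $\mathcal{O}$-operator $r^\sharp$ are equivalent.
   Context: The base field $k$ has characteristic zero. A (multiplicative) hom-Lie algebra $(\mathfrak{g},[\cdot,\cdot],\alpha)$ is a vector space $\mathfrak{g}$ with a skew-symmetric bilinear bracket and a linear map $\alpha:\mathfrak{g}\to\mathfrak{g}$ with $\alpha[x,y]=[\alpha(x),\alpha(y)]$ and $[\alpha(x),[y,z]]+[\alpha(y),[z,x]]+[\alpha(z),[x,y]]=0$; it is regular if $\alpha$ is invertible. A representation $(V,\beta,\rho)$ is a vector space $V$, $\beta\in\mathrm{End}(V)$ and a linear map $\rho:\mathfrak{g}\to\mathrm{End}(V)$ with $\rho(\alpha(x))(\beta(v))=\beta(\rho(x)(v))$ and $\rho([x,y])(\beta(v))=\rho(\alpha(x))\rho(y)(v)-\rho(\alpha(y))\rho(x)(v)$. An $\mathcal{O}$-operator with respect to $(V,\beta,\rho)$ is a linear map $T:V\to\mathfrak{g}$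 with $T\circ\beta=\alpha\circ T$ and $[Tu,Tv]=T(\rho(Tu)(v)-\rho(Tv)(u))$. The coadjoint representation of a regular hom-Lie algebra is $(\mathfrak{g}^*,(\alpha^{-1})^*,\mathrm{ad}^\star)$ with $\langle\mathrm{ad}^\star(x)(\xi),y\rangle=-\langle\xi,[\alpha^{-1}(x),\alpha^{-2}(y)]\rangle$. On $\wedge^*\mathfrak{g}$ define $$[x_1\wedge\cdots\wedge x_n,y_1\wedge\cdots\wedge y_m]_g=\sum_{i,j}(-1)^{i+j}[x_i,y_j]\wedge\alpha(x_1)\wedge\cdots\widehat{\alpha(x_i)}\cdots\wedge\alpha(x_n)\wedge\alpha(y_1)\wedge\cdots\widehat{\alpha(y_j)}\cdots\wedge\alpha(y_m)$$ and $\tilde\alpha(x_1\wedge\cdots\wedge x_n)=\alpha(x_1)\wedge\cdots\wedge\alpha(x_n)$; $\mathcal{H}^n=\{\chi\in\wedge^n\mathfrak{g}\mid\tilde\alpha(\chi)=\chi\}$. A skew-symmetric $r$-matrix is $r\in\mathcal{H}^2$ with $[r,r]_g=0$. Elements of $\wedge^2\mathfrak{g}$ are regarded in $\mathfrak{g}\otimes\mathfrak{g}$ via $x\wedge y\mapsto x\otimes y-y\otimes x$, and $r^\sharp:\mathfrak{g}^*\to\mathfrak{g}$ is given by $\langle\xi,r^\sharp(\eta)\rangle=\langle\xi\otimes\eta,r\rangle$. For a skew-symmetric $r$-matrix $r$, $r^\sharp$ is an $\mathcal{O}$-operator with respect to the coadjoint representation. Deformations of $r$: $\tau\in\mathcal{H}^2$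 generates a linear deformation $r_t=r+t\tau$ of $r$ if $r_t$ is a skew-symmetric $r$-matrix (for all $t\in k$). Put $\mathrm{ad}_x^\dagger(y)=\alpha^{-1}[x,y]$. Linear deformations $r^1_t=r+t\tau_1$ and $r^2_t=r+t\tau_2$ are equivalent if there is $x\in\mathfrak{g}$ with $\alpha(x)=x$ such that, for all $t$, the maps $\phi=\mathrm{Id}+t\,\mathrm{ad}_x^\dagger$ and $\psi=\mathrm{Id}-t\,\mathrm{ad}_x^\dagger$ satisfy: $\phi$ is a hom-Lie algebra homomorphism (preserves the bracket and commutes with $\alpha$), $\psi\circ\alpha=\alpha\circ\psi$, $(\psi\otimes\mathrm{Id})(r^2_t)=(\mathrm{Id}\otimes\phi)(r^1_t)$, and $\psi([\phi(y),z])=[y,\psi(z)]$ for all $y,z\in\mathfrak{g}$. Deformations of an $\mathcal{O}$-operator $T$ with respect to $(V,\beta,\rho)$, $\beta$ invertible: a linear map $\mathfrak{T}:V\to\mathfrak{g}$ with $\mathfrak{T}\circ\beta=\alpha\circ\mathfrak{T}$ generates a linear deformation $T_t=T+t\mathfrak{T}$ if $T_t$ is an $\mathcal{O}$-operator with respect to $(V,\beta,\rho)$ (for all $t\in k$). Linear deformations $T^1_t,T^2_t$ are equivalent if there is $x\in\mathfrak{g}$ with $\alpha(x)=x$ such that, for all $t$, the maps $\phi_{\mathfrak{g}}=\mathrm{Id}_{\mathfrak{g}}+t\,\mathrm{ad}_x^\dagger$ and $\phi_V=\mathrm{Id}_V+t\beta^{-1}\rho(x)$ satisfy: $\phi_{\mathfrak{g}}$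 is a hom-Lie algebra homomorphism, $T^2_t\circ\phi_V=\phi_{\mathfrak{g}}\circ T^1_t$, $\phi_V\circ\beta=\beta\circ\phi_V$, and $\phi_V(\rho(y)(v))=\rho(\phi_{\mathfrak{g}}(y))(\phi_V(v))$ for all $y\in\mathfrak{g},v\in V$. Here this is applied to $T=r^\sharp$ and the coadjoint representation. *)

(* Defs.v *)
From HB Require Import structures.
From mathcomp Require Import all_boot all_algebra boolp.
From mathcomp.multinomials Require Import freeg.

Set Implicit Arguments.
Unset Strict Implicit.
Unset Printing Implicit Defensive.

Import GRing.Theory.
Local Open Scope ring_scope.
Local Open Scope quotient_scope.

Section Span.
Variables (k : fieldType) (V : lmodType k) (A : V -> Prop).

Definition in_span (v : V) : Prop :=
  forall S : V -> Prop,
    S 0 -> (forall a u w, S u -> S w -> S (a *: u + w)) ->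
    (forall u, A u -> S u) -> S v.

Lemma in_span0 : in_span 0.
Proof. by move=> S. Qed.

Lemma in_spanP a u w : in_span u -> in_span w -> in_span (a *: u + w).
Proof. by move=> hu hw S S0 SP SA; apply: (SP); [exact: hu S S0 SP SA|exact: hw S S0 SP SA]. Qed.

Lemma in_span_gen u : A u -> in_span u.
Proof. by move=> Au S _ _; apply. Qed.

Definition spanp : {pred V} := fun v => `[< in_span v >].

Lemma spanp_zmod : zmod_closed spanp.
Proof.
split=> [|x y /asboolP hx /asboolP hy]; first exact: (asboolT in_span0).
by rewrite addrC -scaleN1r; apply: asboolT; apply: in_spanP.
Qed.

HB.instance Definition _ := GRing.isZmodClosed.Build V spanp spanp_zmod.

Definition quotmod : Type := Quotient.quot spanp.

HB.instance Definition _ := GRing.Zmodule.on quotmod.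
HB.instance Definition _ := Quotient.on quotmod.

Definition qproj (v : V) : quotmod := \pi_quotmod v.

Lemma qproj_eq u v : qproj u = qproj v <-> in_span (u - v).
Proof.
split=> [h|h].
  by apply/asboolP; change (u - v \in spanp); rewrite Quotient.idealrBE; apply/eqP.
by apply/eqP; rewrite -[_ == _]Quotient.idealrBE; apply/asboolP.
Qed.

Lemma qprojK (q : quotmod) : qproj (repr q) = q.
Proof. exact: reprK. Qed.

Lemma qprojD u v : qproj (u + v) = qproj u + qproj v.
Proof. exact: (@Quotient.pi_add V spanp). Qed.

Definition qscale (a : k) (q : quotmod) : quotmod := qproj (a *: repr q).

Lemma qprojZ a v : qproj (a *: v) = qscale a (qproj v).
Proof.
apply/qproj_eq; rewrite -scalerBr -[_ *: _]addr0.
by apply: in_spanP in_span0; apply/qproj_eq; rewrite qprojK.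
Qed.

Fact qscaleA a b q : qscale a (qscale b q) = qscale (a * b) q.
Proof. by rewrite -[q]qprojK -!qprojZ scalerA. Qed.
Fact qscale1 q : qscale 1 q = q.
Proof. by rewrite -[q]qprojK -!qprojZ scale1r. Qed.
Fact qscaleDr : right_distributive qscale +%R.
Proof.
by move=> a p q; rewrite -[p]qprojK -[q]qprojK -qprojD -!qprojZ scalerDr qprojD.
Qed.
Fact qscaleDl q : {morph qscale^~ q : a b / a + b}.
Proof. by move=> a b; rewrite -[q]qprojK -!qprojZ scalerDl qprojD. Qed.

HB.instance Definition _ :=
  GRing.Zmodule_isLmodule.Build k quotmod qscaleA qscale1 qscaleDr qscaleDl.

Fact qproj_is_linear : linear qproj.
Proof. by move=> a u v; rewrite qprojD qprojZ. Qed.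
HB.instance Definition _ :=
  GRing.isLinear.Build k V quotmod *:%R qproj qproj_is_linear.

End Span.

Section Presentation.
Variables (k : fieldType) (X : choiceType).
Implicit Type rel : {freeg X / k} -> Prop.

Fact fglift_is_linear (W : lmodType k) (f : X -> W) : linear (fglift f).
Proof.
have fg0 : fglift f 0 = 0.
  by have := lift_is_additive f 0 0; rewrite subr0 subrr.
have fgN w : fglift f (- w) = - fglift f w.
  by have := lift_is_additive f 0 w; rewrite fg0 !sub0r.
have fgD u v : fglift f (u + v) = fglift f u + fglift f v.
  by have := lift_is_additive f u (- v); rewrite fgN !opprK.
have fgS (s : seq X) (c : X -> k) :
    fglift f (\sum_(x <- s) << c x *g x >>) = \sum_(x <- s) c x *: f x.
  elim: s => [|x s IH]; first by rewrite !big_nil.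
  by rewrite !big_cons fgD IH liftU.
move=> a u v; rewrite fgD; congr (_ + _).
transitivity (\sum_(x <- dom u) (a * coeff x u) *: f x); first exact: fgS.
rewrite -[in RHS](freeg_sumE u) fgS.
by rewrite scaler_sumr; apply: eq_bigr => x _; rewrite scalerA.
Qed.
HB.instance Definition _ (W : lmodType k) (f : X -> W) :=
  GRing.isLinear.Build k {freeg X / k} W *:%R (fglift f) (fglift_is_linear f).

Definition pgen rel (x : X) : quotmod rel := qproj rel << x >>.

(* The linear map induced by f on the quotient; meaningful when f kills the
   relations, see plift_gen and plift_linear. *)
Definition plift rel (W : lmodType k) (f : X -> W) (q : quotmod rel) : W :=
  fglift f (repr q).

Definition respects rel (W : lmodType k) (f : X -> W) : Prop :=
  forall u, rel u -> fglift f u = 0.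

Lemma plift_proj rel (W : lmodType k) (f : X -> W) u :
  respects rel f -> plift f (qproj rel u) = fglift f u.
Proof.
move=> hf; apply/eqP; rewrite -subr_eq0 -linearB /=; apply/eqP.
have /qproj_eq : qproj rel (repr (qproj rel u)) = qproj rel u by rewrite qprojK.
move/(_ (fun w => fglift f w = 0)); apply=> //; first exact: linear0.
by move=> a v w hv hw; rewrite linearP /= hv hw scaler0 addr0.
Qed.

Lemma plift_gen rel (W : lmodType k) (f : X -> W) x :
  respects rel f -> plift f (pgen rel x) = f x.
Proof. by move=> hf; rewrite plift_proj // liftU scale1r. Qed.

Lemma plift_linear rel (W : lmodType k) (f : X -> W) :
  respects rel f -> linear (plift (rel := rel) f).
Proof.
move=> hf a p q; rewrite -[p]qprojK -[q]qprojK -linearP !plift_proj //.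
exact: linearP.
Qed.

Lemma plift0 rel (W : lmodType k) (f : X -> W) :
  respects rel f -> plift (rel := rel) f 0 = 0.
Proof.
by move=> hf; rewrite -[X in plift f X](linear0 (qproj rel)) plift_proj // linear0.
Qed.

Lemma pres_ind rel (P : quotmod rel -> Prop) :
  P 0 -> (forall a p q, P p -> P q -> P (a *: p + q)) ->
  (forall x, P (pgen rel x)) -> forall q, P q.
Proof.
move=> P0 PP Pg q; rewrite -[q]qprojK -[repr q]freeg_sumE raddf_sum /=.
elim: (dom _) => [|x s IH]; first by rewrite big_nil.
rewrite big_cons.
have -> : << coeff x (repr q) *g x >> = coeff x (repr q) *: << x >> :> {freeg X / k}.
  by apply/eqP/freeg_eqP => y; rewrite coeffZ !coeffU mul1r.
by rewrite linearZ /=; apply: (PP) => //; apply: Pg.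
Qed.

Lemma plift_ext rel (W : lmodType k) (f h : X -> W) :
  f =1 h -> plift (rel := rel) f =1 plift h.
Proof. by move=> fh; have -> : f = h by apply/funext. Qed.

End Presentation.

Section TensorExterior.
Variables (k : fieldType) (g : lmodType k).

(* g (x) g is the quotient of the free space on g * g by bilinearity. *)
Inductive tens_rel : {freeg (g * g)%type / k} -> Prop :=
| Tens_l a u v y :
    tens_rel (<< (a *: u + v, y) >> - (a *: << (u, y) >> + << (v, y) >>))
| Tens_r x a u v :
    tens_rel (<< (x, a *: u + v) >> - (a *: << (x, u) >> + << (x, v) >>)).

Definition tens := quotmod tens_rel.
HB.instance Definition _ := GRing.Lmodule.on tens.

Definition tensor (x y : g) : tens := pgen tens_rel (x, y).

Lemma tens_respects (W : lmodType k) (f : g -> g -> W) :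
  (forall y, linear (f^~ y)) -> (forall x, linear (f x)) ->
  respects tens_rel (fun z => f z.1 z.2).
Proof.
by move=> fl fr _ [a u v y|x a u v]; rewrite linearB linearP /= !liftU !scale1r
  /= ?fl ?fr subrr.
Qed.

Lemma tensorPl a u v y : tensor (a *: u + v) y = a *: tensor u y + tensor v y.
Proof.
apply/eqP; rewrite -subr_eq0 -linearP -linearB; apply/eqP.
rewrite -(linear0 (qproj tens_rel)); apply/qproj_eq; rewrite subr0.
by apply: in_span_gen; apply: Tens_l.
Qed.
Lemma tensorPr x a u v : tensor x (a *: u + v) = a *: tensor x u + tensor x v.
Proof.
apply/eqP; rewrite -subr_eq0 -linearP -linearB; apply/eqP.
rewrite -(linear0 (qproj tens_rel)); apply/qproj_eq; rewrite subr0.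
by apply: in_span_gen; apply: Tens_r.
Qed.

(* The exterior algebra, all degrees together, is the quotient of the free
   space on lists by multilinearity and alternation; [:: x_1; ...; x_n] stands
   for x_1 /\ ... /\ x_n. *)
Inductive ext_rel : {freeg (seq g) / k} -> Prop :=
| Ext_lin p s a u v :
    ext_rel (<< p ++ (a *: u + v) :: s >>
             - (a *: << p ++ u :: s >> + << p ++ v :: s >>))
| Ext_alt p q s u : ext_rel << p ++ u :: q ++ u :: s >>.

Definition ext := quotmod ext_rel.
HB.instance Definition _ := GRing.Lmodule.on ext.

Definition wedge (x : seq g) : ext := pgen ext_rel x.

(* wedge^n g as a subspace of ext *)
Definition in_ext (n : nat) (chi : ext) : Prop :=
  in_span (fun w => exists2 x, size x = n & w = wedge x) chi.

Definition multilin (W : lmodType k) (F : seq g -> W) : Prop :=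
  forall p s a u v,
    F (p ++ (a *: u + v) :: s) = a *: F (p ++ u :: s) + F (p ++ v :: s).
Definition alternating (W : lmodType k) (F : seq g -> W) : Prop :=
  forall p q s u, F (p ++ u :: q ++ u :: s) = 0.

Lemma ext_respects (W : lmodType k) (F : seq g -> W) :
  multilin F -> alternating F -> respects ext_rel F.
Proof.
move=> Fl Fa _ [p s a u v|p q s u]; last by rewrite liftU Fa scaler0.
by rewrite linearB linearP /= !liftU !scale1r Fl subrr.
Qed.

Lemma wedge_multilin : multilin wedge.
Proof.
move=> p s a u v; apply/eqP; rewrite -subr_eq0 -linearP -linearB; apply/eqP.
rewrite -(linear0 (qproj ext_rel)); apply/qproj_eq; rewrite subr0.
by apply: in_span_gen; apply: Ext_lin.
Qed.

Lemma wedge_alternating : alternating wedge.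
Proof.
move=> p q s u; rewrite -(linear0 (qproj ext_rel)); apply/qproj_eq.
by rewrite subr0; apply: in_span_gen; apply: Ext_alt.
Qed.

Lemma alt_swap (W : lmodType k) (F : seq g -> W) p s u v :
  multilin F -> alternating F -> F (p ++ u :: v :: s) = - F (p ++ v :: u :: s).
Proof.
move=> Fl Fa; apply/eqP; rewrite -addr_eq0; apply/eqP.
have FD q t x y : F (q ++ (x + y) :: t) = F (q ++ x :: t) + F (q ++ y :: t).
  by rewrite -[x]scale1r Fl !scale1r.
have := Fa p [::] s (u + v); rewrite /= FD.
have FD1 q t w x y : F (q ++ w :: (x + y) :: t) =
    F (q ++ w :: x :: t) + F (q ++ w :: y :: t).
  by have := FD (rcons q w) t x y; rewrite -!cats1 -!catA.
rewrite !FD1 (Fa p [::] s u) (Fa p [::] s v) add0r addr0.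
by [].
Qed.

Lemma alt_move (W : lmodType k) (F : seq g -> W) p q s u :
  multilin F -> alternating F ->
  F (p ++ q ++ u :: s) = (-1) ^+ size q *: F (p ++ u :: q ++ s).
Proof.
move=> Fl Fa; elim: q p => [|v q IH] p /=; first by rewrite scale1r.
have := IH (rcons p v); rewrite -cats1 -!catA /= => ->.
by rewrite (alt_swap _ _ v u) // scalerN -scaleNr exprS mulN1r.
Qed.

(* x_1 ... x_i ... x_n with the entry of index i (from 0) omitted *)
Definition del (i : nat) (x : seq g) : seq g := take i x ++ drop i.+1 x.

Definition alt_expand (W : lmodType k) (H : g -> seq g -> W) (x : seq g) : W :=
  \sum_(i < size x) (-1) ^+ i *: H x`_i (del i x).

Lemma alt_expand_cons (W : lmodType k) (H : g -> seq g -> W) u s :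
  alt_expand H (u :: s) = H u s - alt_expand (fun w l => H w (u :: l)) s.
Proof.
rewrite /alt_expand /= big_ord_recl /= expr0 scale1r /del /= drop0; congr (_ + _).
rewrite -sumrN; apply: eq_bigr => i _.
by rewrite /= /bump /= add1n exprS mulN1r scaleNr.
Qed.

Lemma alt_expand_cat (W : lmodType k) (H : g -> seq g -> W) p s :
  alt_expand H (p ++ s) = alt_expand (fun w l => H w (l ++ s)) p
    + (-1) ^+ size p *: alt_expand (fun w l => H w (p ++ l)) s.
Proof.
elim: p H => [|u p IH] H /=.
  by rewrite {2}/alt_expand big_ord0 add0r expr0 scale1r.
by rewrite !alt_expand_cons IH opprD addrA exprS mulN1r scaleNr.
Qed.

Lemma alt_expand_linear (W : lmodType k) (H1 H2 H3 : g -> seq g -> W) a x :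
  (forall w l, H1 w l = a *: H2 w l + H3 w l) ->
  alt_expand H1 x = a *: alt_expand H2 x + alt_expand H3 x.
Proof.
move=> h; rewrite /alt_expand scaler_sumr -big_split; apply: eq_bigr => i _.
by rewrite h scalerDr !scalerA mulrC.
Qed.

Lemma alt_expand0 (W : lmodType k) (H : g -> seq g -> W) x :
  (forall w l, H w l = 0) -> alt_expand H x = 0.
Proof. by move=> h; rewrite /alt_expand big1 // => i _; rewrite h scaler0. Qed.

Lemma alt_expand_multilin (W : lmodType k) (H : g -> seq g -> W) :
  (forall l, linear (H^~ l)) -> (forall w, multilin (H w)) ->
  multilin (alt_expand H).
Proof.
move=> Hl Hm p s a u v; rewrite !alt_expand_cat !alt_expand_cons.
rewrite (@alt_expand_linear _ _ (fun w l => H w (l ++ u :: s))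
  (fun w l => H w (l ++ v :: s)) a); last by move=> w l; apply: Hm.
rewrite (@alt_expand_linear _ (fun w l => H w (p ++ (a *: u + v) :: l))
  (fun w l => H w (p ++ u :: l)) (fun w l => H w (p ++ v :: l)) a); last first.
  by move=> w l; apply: Hm.
rewrite Hl opprD addrACA -scalerBr [in LHS]scalerDr.
by rewrite [_ *: (a *: _)]scalerA [_ * a]mulrC -[(a * _) *: _]scalerA addrACA
  -[in LHS]scalerDr.
Qed.

Lemma alt_expand_alternating (W : lmodType k) (H : g -> seq g -> W) :
  (forall w, multilin (H w)) -> (forall w, alternating (H w)) ->
  alternating (alt_expand H).
Proof.
move=> Hm Ha p q s u; rewrite !alt_expand_cat alt_expand_cons alt_expand_cat.
rewrite alt_expand_cons !alt_expand0 => [|w l|w l|w l].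
- rewrite !add0r subr0 -(alt_move p q s u (Hm u) (Ha u)).
  by rewrite subrr scaler0.
all: exact: Ha.
Qed.

(* x /\ y |-> x (x) y - y (x) x; other degrees are sent to 0 *)
Definition tens_of_list (x : seq g) : tens :=
  if x is [:: u; v] then tensor u v - tensor v u else 0.

Definition ext_tens (chi : ext) : tens := plift tens_of_list chi.

Lemma tens_of_list_respects : respects ext_rel tens_of_list.
Proof.
apply: ext_respects.
  move=> [|x [|y p]] [|z [|t s]] a u v //=; rewrite ?scaler0 ?addr0 //.
  - by rewrite tensorPl tensorPr opprD scalerBr -!addrA; congr (_ + _);
      rewrite addrCA.
  - by rewrite tensorPl tensorPr opprD scalerBr -!addrA; congr (_ + _);
      rewrite addrCA.
  - by case: p => [|? ?] /=; rewrite scaler0 addr0.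
  - by case: p => [|? ?] /=; rewrite scaler0 addr0.
  - by case: p => [|? ?] /=; rewrite scaler0 addr0.
move=> [|x [|y p]] [|z q] s u //=; try by case: q.
  by case: s => //=; rewrite subrr.
all: by case: p.
Qed.

HB.instance Definition _ := GRing.isLinear.Build k ext tens *:%R ext_tens
  (plift_linear tens_of_list_respects).

Lemma ext_tens_wedge u v :
  ext_tens (wedge [:: u; v]) = tensor u v - tensor v u.
Proof. exact: plift_gen tens_of_list_respects. Qed.

Definition tens_map (f h : {linear g -> g}) (t : tens) : tens :=
  plift (fun z => tensor (f z.1) (h z.2)) t.

Lemma tens_map_respects (f h : {linear g -> g}) :
  respects tens_rel (fun z => tensor (f z.1) (h z.2)).
Proof.
by apply: (@tens_respects _ (fun x y => tensor (f x) (h y))) => ? ? ? ? /=;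
  rewrite linearP ?tensorPl ?tensorPr.
Qed.

HB.instance Definition _ f h := GRing.isLinear.Build k tens tens *:%R
  (tens_map f h) (plift_linear (@tens_map_respects f h)).

Lemma tens_mapE (f h : {linear g -> g}) x y :
  tens_map f h (tensor x y) = tensor (f x) (h y).
Proof. exact: plift_gen (@tens_map_respects f h). Qed.

End TensorExterior.

Section Dual.
Variables (k : fieldType) (g : lmodType k).

Definition dual : Type := {linear g -> k^o}.

Definition dual_fun (xi : dual) : g -> k^o := xi.
Coercion dual_fun : dual >-> Funclass.
HB.instance Definition _ (xi : dual) :=
  GRing.Linear.copy (dual_fun xi) (GRing.Linear.sort xi).

Lemma dual_ext (xi eta : dual) : xi =1 eta -> xi = eta.
Proof.
case: xi eta => [f [[a] [b]]] [h [[c] [d]]]; rewrite /dual_fun /= => /funext fh.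
rewrite -{}fh in c d *.
by rewrite (Prop_irrelevance a c) (Prop_irrelevance b d).
Qed.

HB.instance Definition _ := gen_eqMixin dual.
HB.instance Definition _ := gen_choiceMixin dual.

Definition dual0 : dual := (\0 : g -> k^o) : {linear g -> k^o}.
Definition dualN (xi : dual) : dual := (\- dual_fun xi) : {linear g -> k^o}.
Definition dualD (xi eta : dual) : dual := (dual_fun xi \+ dual_fun eta) : {linear g -> k^o}.
Definition dualZ (a : k) (xi : dual) : dual := (a \*: dual_fun xi) : {linear g -> k^o}.

Fact dualA : associative dualD.
Proof. by move=> x y z; apply: dual_ext => u; apply: addrA. Qed.
Fact dualC : commutative dualD.
Proof. by move=> x y; apply: dual_ext => u; apply: addrC. Qed.
Fact dual0D : left_id dual0 dualD.
Proof. by move=> x; apply: dual_ext => u; apply: add0r. Qed.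
Fact dualND : left_inverse dual0 dualN dualD.
Proof. by move=> x; apply: dual_ext => u; apply: addNr. Qed.
HB.instance Definition _ := GRing.isZmodule.Build dual dualA dualC dual0D dualND.

Fact dualZA a b xi : dualZ a (dualZ b xi) = dualZ (a * b) xi.
Proof. by apply: dual_ext => u; apply: scalerA. Qed.
Fact dualZ1 : left_id 1 dualZ.
Proof. by move=> xi; apply: dual_ext => u; apply: scale1r. Qed.
Fact dualZDr : right_distributive dualZ +%R.
Proof. by move=> a x y; apply: dual_ext => u; apply: scalerDr. Qed.
Fact dualZDl xi : {morph dualZ^~ xi : a b / a + b}.
Proof. by move=> a b; apply: dual_ext => u; apply: scalerDl. Qed.
HB.instance Definition _ :=
  GRing.Zmodule_isLmodule.Build k dual dualZA dualZ1 dualZDr dualZDl.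

Lemma dualPE a (xi eta : dual) u : (a *: xi + eta) u = a * xi u + eta u.
Proof. by []. Qed.

Lemma dualP (xi : dual) a u v : xi (a *: u + v) = a * xi u + xi v.
Proof. exact: linearP. Qed.

Definition transpose (f : {linear g -> g}) (xi : dual) : dual :=
  (dual_fun xi \o f) : {linear g -> k^o}.

Fact transpose_is_linear f : linear (transpose f).
Proof. by move=> a xi eta; apply: dual_ext. Qed.
HB.instance Definition _ f := GRing.isLinear.Build k dual dual *:%R
  (transpose f) (transpose_is_linear f).

Definition tens_pair (xi eta : dual) (t : tens g) : k^o :=
  plift (fun z => xi z.1 * eta z.2 : k^o) t.

(* x (x) y |-> eta(y) x, i.e. <xi, r# eta> = <xi (x) eta, r>: see sharpP. *)
Definition sharp (r : ext g) (eta : dual) : g :=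
  plift (fun z => (eta z.2 : k) *: z.1) (ext_tens r).

Lemma tens_pair_respects (xi eta : dual) :
  respects (@tens_rel k g) (fun z => xi z.1 * eta z.2 : k^o).
Proof.
apply: (@tens_respects _ _ k^o (fun x y => xi x * eta y)) => [y|x] a u v /=;
  rewrite linearP.
  by rewrite mulrDl -mulrA.
by rewrite mulrDr mulrCA.
Qed.

Lemma sharp_respects (eta : dual) :
  respects (@tens_rel k g) (fun z => (eta z.2 : k) *: z.1).
Proof.
apply: (@tens_respects _ _ g (fun x y => (eta y : k) *: x)) => [y|x] a u v /=.
  by rewrite scalerDr !scalerA mulrC.
by rewrite linearP scalerDl scalerA.
Qed.

Lemma tens_pair_tensor (xi eta : dual) x y :
  tens_pair xi eta (tensor x y) = xi x * eta y.
Proof. exact: plift_gen (@tens_pair_respects xi eta). Qed.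

Lemma sharpP (r : ext g) (xi eta : dual) :
  xi (sharp r eta) = tens_pair xi eta (ext_tens r).
Proof.
have hs := @sharp_respects eta; have hp := @tens_pair_respects xi eta.
rewrite /sharp /tens_pair; move: (ext_tens r).
apply: pres_ind => [|a p q IHp IHq|z].
- by rewrite (plift0 hs) (plift0 hp) linear0.
- by rewrite (plift_linear hs) (plift_linear hp) dualP IHp IHq.
by rewrite (plift_gen _ hs) (plift_gen _ hp) linearZ mulrC.
Qed.

Fact sharp_is_linear (r : ext g) : linear (sharp r).
Proof.
move=> a xi eta; rewrite /sharp; move: (ext_tens r).
apply: pres_ind => [|b p q hp hq|z].
- by rewrite !plift0 ?scaler0 ?addr0 //; apply: sharp_respects.
- rewrite !(plift_linear (@sharp_respects _)) hp hq !scalerDr !scalerA.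
  by rewrite mulrC addrACA.
rewrite !plift_gen; try exact: sharp_respects.
by rewrite dualPE scalerDl scalerA.
Qed.
HB.instance Definition _ (r : ext g) :=
  GRing.isLinear.Build k dual g *:%R (sharp r) (sharp_is_linear r).

End Dual.

Record hom_lie (k : fieldType) (g : lmodType k) := HomLie {
  br : g -> g -> g;
  alpha : {linear g -> g};
  br_linearl : forall y, linear (br^~ y);
  br_linearr : forall x, linear (br x);
  br_skew : forall x y, br x y = - br y x;
  alpha_br : forall x y, alpha (br x y) = br (alpha x) (alpha y);
  hom_jacobi : forall x y z,
    br (alpha x) (br y z) + br (alpha y) (br z x) + br (alpha z) (br x y) = 0
}.

Record reg_hom_lie (k : fieldType) (g : lmodType k) := RegHomLie {
  reg_base :> hom_lie g;
  alphaV : {linear g -> g};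
  alphaK : cancel (alpha reg_base) alphaV;
  alphaVK : cancel alphaV (alpha reg_base)
}.

Section HomLie.
Variables (k : fieldType) (g : lmodType k).

Definition hom_lie_morphism (L : hom_lie g) (f : {linear g -> g}) : Prop :=
  (forall x y, f (br L x y) = br L (f x) (f y)) /\
  (forall x, f (alpha L x) = alpha L (f x)).

Section Bracket.
Variable L : hom_lie g.

(* Indices start at 0 on both sides, which leaves (-1)^(i+j) unchanged. *)
Definition br_wedge (x y : seq g) : ext g :=
  \sum_(i < size x) \sum_(j < size y) (-1) ^+ (i + j) *:
    wedge (br L x`_i y`_j :: map (alpha L) (del i x) ++ map (alpha L) (del j y)).

(* [.,.]_g, the bilinear extension of br_wedge: see hbr_wedge, hbr_linearl,
   hbr_linearr. *)
Definition hbr (chi omega : ext g) : ext g :=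
  plift (fun x => plift (br_wedge x) omega) chi.

Definition talpha (chi : ext g) : ext g :=
  plift (fun x => wedge (map (alpha L) x)) chi.

Lemma br_wedgel x y : br_wedge x y =
  alt_expand (fun u l => \sum_(j < size y) (-1) ^+ j *:
    wedge (br L u y`_j :: map (alpha L) l ++ map (alpha L) (del j y))) x.
Proof.
apply: eq_bigr => i _; rewrite scaler_sumr; apply: eq_bigr => j _.
by rewrite scalerA exprD.
Qed.

Lemma br_wedger x y : br_wedge x y =
  alt_expand (fun v l => \sum_(i < size x) (-1) ^+ i *:
    wedge (br L x`_i v :: map (alpha L) (del i x) ++ map (alpha L) l)) y.
Proof.
rewrite /br_wedge exchange_big; apply: eq_bigr => j _.
rewrite scaler_sumr; apply: eq_bigr => i _.
by rewrite scalerA addnC exprD.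
Qed.

Lemma sum_scale_linear n (W : lmodType k) (c : 'I_n -> k) (F1 F2 F3 : 'I_n -> W) a :
  (forall i, F1 i = a *: F2 i + F3 i) ->
  \sum_(i < n) c i *: F1 i = a *: (\sum_(i < n) c i *: F2 i) + \sum_(i < n) c i *: F3 i.
Proof.
move=> h; rewrite scaler_sumr -big_split; apply: eq_bigr => i _.
by rewrite h scalerDr !scalerA mulrC.
Qed.

Lemma wedge_map_multilin (p s : seq g) (F : seq g -> seq g) :
  (forall x, F x = p ++ map (alpha L) x ++ s) -> multilin (fun x => wedge (F x)).
Proof.
move=> hF q t a u v; rewrite !hF !map_cat /= linearP.
have := wedge_multilin (p ++ map (alpha L) q) (map (alpha L) t ++ s) a.
by move=> /(_ (alpha L u) (alpha L v)); rewrite -!catA.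
Qed.

Lemma wedge_map_alternating (p s : seq g) (F : seq g -> seq g) :
  (forall x, F x = p ++ map (alpha L) x ++ s) -> alternating (fun x => wedge (F x)).
Proof.
move=> hF q t w u; rewrite !hF !map_cat /= map_cat /=.
have := wedge_alternating (p ++ map (alpha L) q) (map (alpha L) t).
by move=> /(_ (map (alpha L) w ++ s) (alpha L u)); rewrite -!catA /= -catA.
Qed.

Lemma br_wedge_multilinl y : multilin (br_wedge^~ y).
Proof.
move=> p s a u v; rewrite !br_wedgel; apply: alt_expand_multilin.
  move=> l b w z; apply: sum_scale_linear => j.
  by rewrite br_linearl (wedge_multilin [::]).
move=> w p' s' b u' v'; apply: sum_scale_linear => j.
exact: (@wedge_map_multilin [:: br L w y`_j] (map (alpha L) (del j y))
  (fun l => br L w y`_j :: map (alpha L) l ++ map (alpha L) (del j y))).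
Qed.

Lemma br_wedge_alternatingl y : alternating (br_wedge^~ y).
Proof.
move=> p q s u; rewrite br_wedgel; apply: alt_expand_alternating.
  move=> w p' s' b u' v'; apply: sum_scale_linear => j.
  exact: (@wedge_map_multilin [:: br L w y`_j] (map (alpha L) (del j y))
    (fun l => br L w y`_j :: map (alpha L) l ++ map (alpha L) (del j y))).
move=> w p' q' s' u'; apply: big1 => j _.
rewrite (@wedge_map_alternating [:: br L w y`_j] (map (alpha L) (del j y))
    (fun l => br L w y`_j :: map (alpha L) l ++ map (alpha L) (del j y))) //.
exact: scaler0.
Qed.

Lemma br_wedge_multilinr x : multilin (br_wedge x).
Proof.
move=> p s a u v; rewrite !br_wedger; apply: alt_expand_multilin.
  move=> l b w z; apply: sum_scale_linear => j.
  by rewrite br_linearr (wedge_multilin [::]).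
move=> w p' s' b u' v'; apply: sum_scale_linear => i.
apply: (@wedge_map_multilin (br L x`_i w :: map (alpha L) (del i x)) [::]
  (fun l => br L x`_i w :: map (alpha L) (del i x) ++ map (alpha L) l)) => l.
by rewrite cats0.
Qed.

Lemma br_wedge_alternatingr x : alternating (br_wedge x).
Proof.
have E i w l : br L x`_i w :: map (alpha L) (del i x) ++ map (alpha L) l =
  (br L x`_i w :: map (alpha L) (del i x)) ++ map (alpha L) l ++ [::].
  by rewrite cats0.
move=> p q s u; rewrite br_wedger; apply: alt_expand_alternating.
  move=> w p' s' b u' v'; apply: sum_scale_linear => i.
  exact: (wedge_map_multilin (E i w)).
move=> w p' q' s' u'; apply: big1 => i _.
by rewrite (wedge_map_alternating (E i w)) scaler0.
Qed.

Lemma br_wedge_respectsr x : respects (@ext_rel k g) (br_wedge x).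
Proof.
exact: ext_respects (@br_wedge_multilinr x) (@br_wedge_alternatingr x).
Qed.

Lemma hbr_respects omega :
  respects (@ext_rel k g) (fun x => plift (rel := @ext_rel k g) (br_wedge x) omega).
Proof.
have respl y := ext_respects (@br_wedge_multilinl y) (@br_wedge_alternatingl y).
have lin x := plift_linear (@br_wedge_respectsr x).
apply: ext_respects => [p s a u v|p q s u]; move: omega.
- apply: pres_ind => [|b m n hm hn|y].
  + by rewrite !plift0 ?scaler0 ?addr0 //; apply: br_wedge_respectsr.
  + rewrite !lin hm hn !scalerDr -!addrA; congr (_ + _).
      by rewrite !scalerA mulrC.
    by rewrite addrCA.
  + by rewrite !plift_gen; [exact: br_wedge_multilinl|..];
      apply: br_wedge_respectsr.
- apply: pres_ind => [|b m n hm hn|y].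
  + by rewrite plift0 //; apply: br_wedge_respectsr.
  + by rewrite lin hm hn scaler0 addr0.
  + rewrite plift_gen; first exact: br_wedge_alternatingl.
    exact: br_wedge_respectsr.
Qed.

Lemma hbr_wedge x y : hbr (wedge x) (wedge y) = br_wedge x y.
Proof.
rewrite /hbr plift_gen; last exact: hbr_respects.
by rewrite plift_gen //; apply: br_wedge_respectsr.
Qed.

Lemma hbr_linearl omega : linear (hbr^~ omega).
Proof. exact: plift_linear (@hbr_respects omega). Qed.

Lemma hbr_linearr chi : linear (hbr chi).
Proof.
have lin x := plift_linear (@br_wedge_respectsr x).
move=> a m n; move: chi; apply: pres_ind => [|b p q hp hq|x].
- by rewrite /hbr !plift0 ?scaler0 ?addr0 //; apply: hbr_respects.
- rewrite !hbr_linearl hp hq !scalerDr -!addrA; congr (_ + _).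
    by rewrite !scalerA mulrC.
  by rewrite addrCA.
- by rewrite /hbr !plift_gen ?lin //; apply: hbr_respects.
Qed.

Lemma talpha_respects :
  respects (@ext_rel k g) (fun x => wedge (map (alpha L) x)).
Proof.
have E l : map (alpha L) l = [::] ++ map (alpha L) l ++ [::] by rewrite cats0.
exact: ext_respects (wedge_map_multilin E) (wedge_map_alternating E).
Qed.

HB.instance Definition _ := GRing.isLinear.Build k (ext g) (ext g) *:%R talpha
  (plift_linear talpha_respects).

Lemma talpha_wedge x : talpha (wedge x) = wedge (map (alpha L) x).
Proof. exact: plift_gen talpha_respects. Qed.

(* The space H^n of talpha-fixed elements of degree n. *)
Definition invariant_ext (n : nat) (chi : ext g) : Prop :=
  in_ext n chi /\ talpha chi = chi.

Definition skew_rmatrix (r : ext g) : Prop :=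
  invariant_ext 2 r /\ hbr r r = 0.

End Bracket.

Record hom_rep (L : hom_lie g) (V : lmodType k) := HomRep {
  beta : {linear V -> V};
  rho : g -> {linear V -> V};
  rho_linear : forall a x y v, rho (a *: x + y) v = a *: rho x v + rho y v;
  rho_alpha : forall x v, rho (alpha L x) (beta v) = beta (rho x v);
  rho_br : forall x y v, rho (br L x y) (beta v) =
    rho (alpha L x) (rho y v) - rho (alpha L y) (rho x v)
}.

Record reg_hom_rep (L : hom_lie g) (V : lmodType k) := RegHomRep {
  rep_base :> hom_rep L V;
  betaV : {linear V -> V};
  betaK : cancel (beta rep_base) betaV;
  betaVK : cancel betaV (beta rep_base)
}.

Definition o_operator (L : hom_lie g) (V : lmodType k) (P : hom_rep L V)
    (T : {linear V -> g}) : Prop :=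
  (forall v, T (beta P v) = alpha L (T v)) /\
  (forall u v, br L (T u) (T v) = T (rho P (T u) v - rho P (T v) u)).

Definition generates_o_deformation (L : hom_lie g) (V : lmodType k)
    (P : hom_rep L V) (T T' : {linear V -> g}) : Prop :=
  (forall v, T' (beta P v) = alpha L (T' v)) /\
  (forall t : k, o_operator P (T \+ t \*: T')).

Definition generates_r_deformation (L : hom_lie g) (r tau : ext g) : Prop :=
  invariant_ext L 2 tau /\ forall t : k, skew_rmatrix L (r + t *: tau).

Variable L : reg_hom_lie g.

Definition ad_dagger (x y : g) : g := alphaV L (br L x y).

Fact ad_dagger_is_linear x : linear (ad_dagger x).
Proof. by move=> a u v; rewrite /ad_dagger br_linearr linearP. Qed.
HB.instance Definition _ x :=
  GRing.isLinear.Build k g g *:%R (ad_dagger x) (ad_dagger_is_linear x).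

Definition phi_g (t : k) (x : g) : {linear g -> g} :=
  (idfun \+ t \*: ad_dagger x) : {linear g -> g}.

Definition psi_g (t : k) (x : g) : {linear g -> g} :=
  (idfun \- t \*: ad_dagger x) : {linear g -> g}.

Definition phi_V (V : lmodType k) (P : reg_hom_rep L V) (t : k) (x : g) (v : V) : V :=
  v + t *: betaV P (rho P x v).

(* A deformation is given by its family: r1 is t |-> r^1_t, below T1 is
   t |-> T^1_t. *)
Definition r_deformations_equivalent (r1 r2 : k -> ext g) : Prop :=
  exists x : g, alpha L x = x /\ forall t : k,
    [/\ hom_lie_morphism L (phi_g t x),
        forall y, psi_g t x (alpha L y) = alpha L (psi_g t x y),
        tens_map (psi_g t x) idfun (ext_tens (r2 t)) =
          tens_map idfun (phi_g t x) (ext_tens (r1 t)) &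
        forall y z, psi_g t x (br L (phi_g t x y) z) = br L y (psi_g t x z)].

Definition o_deformations_equivalent (V : lmodType k) (P : reg_hom_rep L V)
    (T1 T2 : k -> {linear V -> g}) : Prop :=
  exists x : g, alpha L x = x /\ forall t : k,
    [/\ hom_lie_morphism L (phi_g t x),
        forall v, T2 t (phi_V P t x v) = phi_g t x (T1 t v),
        forall v, phi_V P t x (beta P v) = beta P (phi_V P t x v) &
        forall y v, phi_V P t x (rho P y v) =
                    rho P (phi_g t x y) (phi_V P t x v)].

Definition coad_fun (x : g) (xi : dual g) (y : g) : k^o :=
  - xi (br L (alphaV L x) (alphaV L (alphaV L y))).

Fact coad_fun_is_linear x xi : linear (coad_fun x xi).
Proof.
by move=> a u v; rewrite /coad_fun !linearP br_linearr dualP opprD -mulrN.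
Qed.
HB.instance Definition _ x xi :=
  GRing.isLinear.Build k g k^o *:%R (coad_fun x xi) (coad_fun_is_linear x xi).

Definition coad (x : g) (xi : dual g) : dual g := coad_fun x xi : {linear g -> k^o}.

Fact coad_is_linear x : linear (coad x).
Proof.
move=> a xi eta; apply: dual_ext => y.
by rewrite dualPE /coad /dual_fun /= /coad_fun dualPE opprD -mulrN.
Qed.
HB.instance Definition _ x :=
  GRing.isLinear.Build k (dual g) (dual g) *:%R (coad x) (coad_is_linear x).

Lemma coadE x xi y : coad x xi y = - xi (br L (alphaV L x) (alphaV L (alphaV L y))).
Proof. by []. Qed.

Lemma transposeE (f : {linear g -> g}) (xi : dual g) y : transpose f xi y = xi (f y).
Proof. by []. Qed.

Lemma alphaV_br x y : alphaV L (br L x y) = br L (alphaV L x) (alphaV L y).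
Proof. by apply: (can_inj (alphaK L)); rewrite alpha_br !alphaVK. Qed.

Fact coad_linear a x y xi : coad (a *: x + y) xi = a *: coad x xi + coad y xi.
Proof.
apply: dual_ext => z; rewrite dualPE !coadE linearP br_linearl dualP opprD.
by rewrite -mulrN.
Qed.

Fact coad_alpha x xi : coad (alpha L x) (transpose (alphaV L) xi) =
  transpose (alphaV L) (coad x xi).
Proof.
apply: dual_ext => z.
by rewrite transposeE !coadE transposeE alphaV_br alphaK.
Qed.

Fact coad_br x y xi : coad (br L x y) (transpose (alphaV L) xi) =
  coad (alpha L x) (coad y xi) - coad (alpha L y) (coad x xi).
Proof.
apply: dual_ext => z; rewrite -scaleN1r addrC dualPE !coadE transposeE.
rewrite !alphaV_br !alphaK mulN1r !opprK.
set X := alphaV L (alphaV L x); set Y := alphaV L (alphaV L y).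
have -> : alphaV L y = alpha L Y by rewrite alphaVK.
have -> : alphaV L x = alpha L X by rewrite alphaVK.
set Z := alphaV L (alphaV L (alphaV L (alphaV L z))).
have -> : alphaV L (alphaV L (alphaV L z)) = alpha L Z by rewrite alphaVK.
have J := hom_jacobi L X Y Z.
have brN u v : br L u (- v) = - br L u v.
  rewrite -scaleN1r -[_ *: v]addr0 br_linearr scaleN1r.
  have := br_linearr L u 1 0 0; rewrite !scale1r !addr0 => /eqP.
  by rewrite -subr_eq0 opprD addNKr oppr_eq0 => /eqP ->; rewrite addr0.
have dD u v : xi (u + v) = xi u + xi v.
  by rewrite -[u in LHS]scale1r dualP mul1r.
have d0 : xi 0 = 0 by apply: (addrI (xi 0)); rewrite -dD !addr0.
have dN u : xi (- u) = - xi u.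
  by apply/eqP; rewrite -addr_eq0 -dD addNr d0.
rewrite (br_skew L _ (alpha L Z)) (br_skew L X Z) brN !dN opprK.
have := d0; rewrite -J !dD => /eqP; rewrite addrC addr_eq0 => /eqP ->.
by rewrite opprD.
Qed.

Fact transposeK : cancel (transpose (alphaV L)) (transpose (alpha L)).
Proof. by move=> xi; apply: dual_ext => y; rewrite !transposeE alphaK. Qed.

Fact transposeVK : cancel (transpose (alpha L)) (transpose (alphaV L)).
Proof. by move=> xi; apply: dual_ext => y; rewrite !transposeE alphaVK. Qed.

Definition coadjoint : reg_hom_rep L (dual g) :=
  @RegHomRep L (dual g)
    (@HomRep L (dual g) (transpose (alphaV L)) coad coad_linear coad_alpha coad_br)
    (transpose (alpha L)) transposeK transposeVK.

End HomLie.

(* Main.v *)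
(* Linear functionals separate the points of g (Zorn), hence also those of
   g (x) g, and, by Euler's identity for contractions in characteristic zero,
   those of wedge^n g.  With B(xi, eta, zeta) =
   <xi, [r# alpha^* eta, r# alpha^* zeta]>, pairing [r, r]_g with
   xi /\ eta /\ zeta gives twice the cyclic sum of B, and invariance and skewness
   of r turn that cyclic sum into the defect of r# from being an O-operator.
   For the equivalences, phi_V of the coadjoint representation is the transpose
   of psi_g, so each condition on the O-operator side is the transpose of one
   on the r-matrix side. *)
Require Import Defs.
From HB Require Import structures.
From mathcomp Require Import all_boot all_algebra ring.
From mathcomp Require Import boolp classical_sets.

Set Implicit Arguments.
Unset Strict Implicit.
Unset Printing Implicit Defensive.

Import GRing.Theory.
Local Open Scope ring_scope.

(** * Linear functionals and finite-rank operators on a space of arbitrary dimension *)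

Section Separation.
Variables (k : fieldType) (g : lmodType k).

(** Zorn's lemma gives a subspace [W] maximal among those avoiding [v]. It is a complement of the
    line spanned by [v], and [f] reads off the coefficient of [v] modulo [W]. *)
Lemma exists_dual_neq0 (v : g) : v != 0 -> exists f : dual g, f v = 1.
Proof.
move=> v0.
pose sub (W : set g) := [/\ W 0, forall a x y, W x -> W y -> W (a *: x + y) & ~ W v].
have sub0 : sub (fun x => x = 0).
  split=> //= [a x y -> ->|/eqP]; first by rewrite scaler0 addr0.
  by rewrite (negbTE v0).
pose leS (W1 W2 : {W | sub W}) := `[< sval W1 `<=` sval W2 >]%classic.
have [||A totA|[W subW] maxW] := @ZL_preorder _ (exist sub _ sub0) leS.
- by move=> t; apply/asboolP.
- by move=> r s t /asboolP rs /asboolP st; apply/asboolP => x /rs /st.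
(* A nonempty chain is bounded by its union; the empty chain, whose union lacks 0, is bounded by the
   zero subspace. *)
- have [[W1 AW1]|A0] := pselect (exists W, A W); last first.
    by exists (exist sub _ sub0) => s As; case: A0; exists s.
  have subU : sub (fun x => exists2 W, A W & sval W x).
    split=> [|a x y [X AX Xx] [Y AY Yy]|[X AX]].
    + by exists W1 => //; case: (svalP W1).
    + have [/asboolP XY|/asboolP YX] := totA _ _ AX AY.
        by exists Y => //; case: (svalP Y) => _ + _; apply=> //; apply: XY.
      by exists X => //; case: (svalP X) => _ + _; apply=> //; apply: YX.
    + by case: (svalP X).
  by exists (exist sub _ subU) => s As; apply/asboolP => x sx; exists s.
have [W0 WP Wv] := subW.
have WZ a x : W x -> W (a *: x) by move=> Wx; rewrite -[_ *: _]addr0; exact: WP.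
have WB x y : W x -> W y -> W (x - y).
  by move=> Wx Wy; rewrite addrC -scaleN1r; exact: WP.
have ex x : exists c : k, W (x - c *: v).
  have [Wx|Wx] := pselect (W x); first by exists 0; rewrite scale0r subr0.
  (* [W'] is [W] enlarged by [x]. If it contains [v = a *: x + w], then [a] is nonzero and [a^-1] is
     the coefficient sought; if not, maximality puts [x] in [W]. *)
  pose W' : set g := fun z => exists2 w, W w & exists a : k, z = a *: x + w.
  have [[w Ww [a va]]|W'v] := pselect (W' v).
    have [a0|a0] := eqVneq a 0.
      by case: Wv; rewrite va a0 scale0r add0r.
    exists a^-1; rewrite va scalerDr scalerA mulVf // scale1r opprD addNKr.
    by rewrite -scaleNr; apply: WZ.
  have subW' : sub W'.
    split=> [|b y z [w Ww [c ->]] [w' Ww' [c' ->]]|].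
    - by exists 0 => //; exists 0; rewrite scale0r addr0.
    - exists (b *: w + w'); first exact: WP.
      by exists (b * c + c'); rewrite scalerDr scalerDl scalerA addrACA.
    - by [].
  have /maxW : leS (exist sub W subW) (exist sub _ subW').
    by apply/asboolP => z Wz; exists z => //; exists 0; rewrite scale0r add0r.
  move/asboolP => /(_ x) W'x; case: Wx; apply: W'x.
  by exists 0 => //; exists 1; rewrite scale1r addr0.
have uniq_coef x c d : W (x - c *: v) -> W (x - d *: v) -> c = d.
  move=> hc hd; apply/eqP; rewrite -subr_eq0; apply/negP => /negP cd.
  apply: Wv; rewrite -[v]scale1r -(mulVf cd) -scalerA; apply: WZ.
  rewrite scalerBl.
  have -> : c *: v - d *: v = (x - d *: v) - (x - c *: v).
    by rewrite opprB [RHS]addrC addrA subrK.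
  exact: WB.
have [f fP] := choice ex.
have f_linear : linear (f : g -> k^o).
  move=> a x y; apply: (uniq_coef (a *: x + y)) => //.
  have -> : a *: x + y - (a *: (f x : k^o) + f y : k^o) *: v =
     a *: (x - f x *: v) + (y - f y *: v).
    by rewrite scalerDl opprD scalerBr scalerA addrACA.
  exact: WP.
pose F : {linear g -> k^o} := HB.pack (f : g -> k^o)
  (GRing.isLinear.Build k g k^o *:%R f f_linear).
exists (F : dual g).
by apply: (uniq_coef v) => //; rewrite scale1r subrr.
Qed.

Lemma dual_separates (u v : g) : (forall f : dual g, f u = f v) -> u = v.
Proof.
move=> h; apply/eqP; rewrite -subr_eq0; apply/negP => /negP /exists_dual_neq0 [f].
by rewrite linearB /= h subrr => /eqP; rewrite eq_sym oner_eq0.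
Qed.

(** [P] encodes an element of [g] (x) [dual g]. Operators fixing a given finite list of vectors
    replace the expansion of the identity in a finite basis. *)
Definition finite_rank (P : seq (g * dual g)) (x : g) : g :=
  \sum_(p <- P) (p.2 x : k) *: p.1.

Fact finite_rank_is_linear P : linear (finite_rank P).
Proof.
move=> a x y; rewrite /finite_rank scaler_sumr -big_split.
by apply: eq_bigr => p _ /=; rewrite dualP scalerDl scalerA.
Qed.
HB.instance Definition _ P :=
  GRing.isLinear.Build k g g *:%R (finite_rank P) (finite_rank_is_linear P).

(** If [P] fixes [s] but not [x], add the rank-one term [y] (x) [f \o (id - P)] with [y = x - P x]
    and [f y = 1]: it vanishes on whatever [P] fixes and supplies the missing [y] at [x]. *)
Lemma exists_finite_rank_fixing (s : seq g) :
  exists P, {in s, forall x, finite_rank P x = x}.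
Proof.
elim: s => [|x s [P fixP]]; first by exists [::].
have [xfix|] := eqVneq (x - finite_rank P x) 0.
  exists P => y; rewrite inE => /predU1P[->|/fixP//].
  by apply/esym/eqP; rewrite -subr_eq0 xfix.
set y := x - _ => /exists_dual_neq0 [f fy].
have f'l : linear (fun z => f (z - finite_rank P z)).
  by move=> a u w; rewrite linearP opprD addrACA -scalerBr linearP.
pose F : {linear g -> k^o} := HB.pack (fun z => f (z - finite_rank P z) : k^o)
  (GRing.isLinear.Build k g k^o *:%R _ f'l).
have FE z : dual_fun (F : dual g) z = f (z - finite_rank P z) by [].
exists ((y, F : dual g) :: P) => z.
rewrite /finite_rank big_cons -/(finite_rank P z) inE FE.
case/predU1P => [->|/fixP zfix]; first by rewrite fy scale1r subrK.
by rewrite zfix subrr linear0 scale0r add0r.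
Qed.

End Separation.

(** * Pairings on g (x) g and contractions on the exterior algebra *)

Section Contraction.
Variables (k : fieldType) (g : lmodType k).
Implicit Types (P : seq (g * dual g)) (s : seq g) (xi eta zeta : dual g).

Lemma tens_pair_linear xi eta (a : k) (t u : tens g) :
  tens_pair xi eta (a *: t + u) = a * tens_pair xi eta t + tens_pair xi eta u.
Proof. exact: plift_linear (@tens_pair_respects _ _ xi eta) a t u. Qed.

(** On a pure tensor, apply [finite_rank P] to both factors and expand. Since every [P] fixing [s]
    is allowed, several tensors can be expanded over one common [P]. *)
Lemma tens_finite_rank_expand (t : tens g) :
  exists s, forall P, {in s, forall x, finite_rank P x = x} ->
    t = \sum_(p <- P) \sum_(q <- P) (tens_pair p.2 q.2 t : k) *: tensor p.1 q.1.
Proof.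
move: t; apply: pres_ind => [|a t u [s1 h1] [s2 h2]|[x y]].
- exists [::] => P _; rewrite big1 // => p _; rewrite big1 // => q _.
  by rewrite /tens_pair plift0 ?scale0r //; apply: tens_pair_respects.
- exists (s1 ++ s2) => P hP.
  rewrite [in LHS](h1 P) => [|z zs]; last by rewrite hP // mem_cat zs.
  rewrite [in LHS](h2 P) => [|z zs]; last by rewrite hP // mem_cat zs orbT.
  rewrite scaler_sumr -big_split; apply: eq_bigr => p _ /=.
  rewrite scaler_sumr -big_split; apply: eq_bigr => q _ /=.
  by rewrite scalerA -scalerDl -tens_pair_linear.
exists [:: x; y] => P hP; rewrite -/(tensor x y).
have hsuml (z : g) : linear (fun x : g => tensor x z) by move=> a u v; rewrite tensorPl.
have hsumr (z : g) : linear (tensor z) by move=> a u v; rewrite tensorPr.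
pose Fl z : {linear g -> tens g} := HB.pack (fun x : g => tensor x z)
  (GRing.isLinear.Build k g (tens g) *:%R _ (hsuml z)).
pose Fr z : {linear g -> tens g} := HB.pack (tensor z)
  (GRing.isLinear.Build k g (tens g) *:%R _ (hsumr z)).
rewrite -[in LHS](hP x) ?mem_head // -[in LHS](hP y) ?inE ?eqxx ?orbT //.
rewrite -[LHS]/(Fl (finite_rank P y) _) linear_sum; apply: eq_bigr => p _.
rewrite linearZ /= -[tensor _ _]/(Fr p.1 (finite_rank P y)) linear_sum scaler_sumr.
apply: eq_bigr => q _.
by rewrite linearZ tens_pair_tensor /= scalerA.
Qed.

Lemma tens_pair_separates (t u : tens g) :
  (forall xi eta, tens_pair xi eta t = tens_pair xi eta u) -> t = u.
Proof.
move=> h; have [s1 h1] := tens_finite_rank_expand t.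
have [s2 h2] := tens_finite_rank_expand u.
have [P fixP] := exists_finite_rank_fixing (s1 ++ s2).
rewrite (h1 P) => [|z zs]; last by rewrite fixP // mem_cat zs.
rewrite (h2 P) => [|z zs]; last by rewrite fixP // mem_cat zs orbT.
by apply: eq_bigr => p _; apply: eq_bigr => q _; rewrite h.
Qed.

Definition contraction_list xi : seq g -> ext g :=
  alt_expand (fun w l => (xi w : k) *: wedge l).

Lemma contraction_respects xi : respects (@ext_rel k g) (contraction_list xi).
Proof.
apply: ext_respects; first apply: alt_expand_multilin.
- by move=> l a u v; rewrite dualP scalerDl scalerA.
- by move=> w p s a u v; rewrite wedge_multilin scalerDr !scalerA mulrC.
apply: alt_expand_alternating => w p s.
- by move=> a u v; rewrite wedge_multilin scalerDr !scalerA mulrC.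
- by move=> t u; rewrite wedge_alternating scaler0.
Qed.

Definition contraction xi : ext g -> ext g := plift (contraction_list xi).

HB.instance Definition _ xi := GRing.isLinear.Build k (ext g) (ext g) *:%R
  (contraction xi) (plift_linear (@contraction_respects xi)).

Lemma contraction_wedge xi s :
  contraction xi (wedge s) = contraction_list xi s.
Proof. exact: plift_gen (@contraction_respects xi). Qed.

Lemma in_ext_contraction n xi (omega : ext g) :
  in_ext n.+1 omega -> in_ext n (contraction xi omega).
Proof.
move=> homega; apply: (homega (fun w => in_ext n (contraction xi w))).
- by rewrite linear0; apply: in_span0.
- by move=> a u w hu hw; rewrite linearP; apply: in_spanP.
move=> _ [s ss ->]; rewrite contraction_wedge.
apply: (big_ind (in_ext n)) => [|u w hu hw|i _]; first exact: in_span0.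
  by rewrite -[u]scale1r; apply: in_spanP.
rewrite scalerA -[_ *: _]addr0; apply: in_spanP; last exact: in_span0.
apply: in_span_gen; exists (del i s) => //.
rewrite /del size_cat size_takel ?size_drop; last exact: ltnW.
by case: i => i /=; rewrite ss subSS ltnS; apply: subnKC.
Qed.

Lemma wedge_cons_respects (e : g) :
  respects (@ext_rel k g) (fun s => wedge (e :: s)).
Proof.
apply: ext_respects => [p s a u v|p q s u]; first exact: (wedge_multilin (e :: p)).
exact: (wedge_alternating (e :: p)).
Qed.

Definition wedge_cons (e : g) : ext g -> ext g := plift (fun s => wedge (e :: s)).

HB.instance Definition _ e := GRing.isLinear.Build k (ext g) (ext g) *:%R
  (wedge_cons e) (plift_linear (@wedge_cons_respects e)).

Lemma wedge_consE e s : wedge_cons e (wedge s) = wedge (e :: s).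
Proof. exact: plift_gen (@wedge_cons_respects e). Qed.

(* Euler's identity: the derivation of the exterior algebra induced by the
   identity multiplies degree n by n. *)
Lemma sum_wedge_cons_contraction P s :
  {in s, forall x, finite_rank P x = x} ->
  \sum_(p <- P) wedge_cons p.1 (contraction p.2 (wedge s)) = (size s)%:R *: wedge s.
Proof.
have FZ (F : {linear ext g -> ext g}) a b u : F (a *: (b *: u)) = a *: (b *: F u).
  by rewrite scalerA linearZ /= scalerA.
(* Summing over [P] first, linearity of the leading factor reassembles [finite_rank P] on the
   extracted entry. *)
move=> fixP; transitivity
  (\sum_(i < size s) (-1) ^+ i *: wedge (finite_rank P s`_i :: del i s)).
  under eq_bigr => p _ do
    rewrite contraction_wedge /contraction_list /alt_expand linear_sum.
  rewrite exchange_big; apply: eq_bigr => i _ /=.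
  transitivity ((-1) ^+ i *: \sum_(p <- P)
      (p.2 s`_i : k) *: wedge (p.1 :: del i s)).
    rewrite scaler_sumr; apply: eq_bigr => p _.
    by rewrite FZ /= wedge_consE.
  congr (_ *: _); rewrite /finite_rank.
  elim: P {fixP} => [|p P IH].
    (* Multilinearity with scalar -1 and both vectors 0 shows that a wedge headed by 0 vanishes. *)
    rewrite !big_nil; have := wedge_multilin [::] (del i s) (-1) 0 (0 : g).
    by rewrite /= scaler0 addr0 scaleN1r addNr => ->.
  by rewrite !big_cons IH (wedge_multilin [::]).
rewrite scaler_nat.
transitivity (\sum_(i < size s) wedge s); last first.
  by rewrite sumr_const card_ord.
(* Moving the extracted entry back to position [i] costs exactly the sign [(-1) ^+ i]. *)
apply: eq_bigr => i _; rewrite fixP ?mem_nth //.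
rewrite -[in RHS](cat_take_drop i s) (drop_nth 0) //.
have := alt_move [::] (take i s) (drop i.+1 s) s`_i
  (@wedge_multilin k g) (@wedge_alternating k g).
by rewrite /= size_take ltn_ord => ->.
Qed.

Hypothesis char0 : [pchar k] =i pred0.

(** Euler's identity writes [n.+1%:R *: omega] as a sum of wedges with contractions of [omega], all
    zero here, and [n.+1] is invertible in characteristic zero. The degree must be positive, as
    contractions kill degree 0. *)
Lemma ext_contraction_eq0 n (omega : ext g) : in_ext n.+1 omega ->
  (forall xi, contraction xi omega = 0) -> omega = 0.
Proof.
move=> homega h.
have [s expand] : exists s, forall P, {in s, forall x, finite_rank P x = x} ->
    \sum_(p <- P) wedge_cons p.1 (contraction p.2 omega) = n.+1%:R *: omega.
  apply: (homega (fun w => exists s, forall P, _ -> _ = _ *: w)) =>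
      [|a u w [s1 h1] [s2 h2]|_ [s ss ->]].
  - exists [::] => P _; rewrite scaler0 big1 // => p _.
    by rewrite !linear0.
  - exists (s1 ++ s2) => P hP.
    rewrite scalerDr scalerA mulrC -scalerA -(h1 P) => [|z zs]; last first.
      by rewrite hP // mem_cat zs.
    rewrite -(h2 P) => [|z zs]; last by rewrite hP // mem_cat zs orbT.
    rewrite scaler_sumr -big_split; apply: eq_bigr => p _ /=.
    by rewrite linearP /= linearP.
  - by exists s => P hP; rewrite sum_wedge_cons_contraction // ss.
have [P /expand] := exists_finite_rank_fixing s.
rewrite big1 => [/esym/eqP|p _]; last by rewrite h linear0.
rewrite scaler_eq0 => /orP[|/eqP //].
by move/pcharf0P: char0 => ->.
Qed.

(** The defining relations involve only nonempty lists, so the indicator of the empty list descends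
    to the quotient. Scalars can thus be read off multiples of [wedge [::]]. *)
Lemma wedge_nil_neq0 : wedge [::] != 0 :> ext g.
Proof.
have resp : respects (@ext_rel k g) (fun s => (size s == 0)%:R : k^o).
  apply: ext_respects => [p s a u v|p q s u]; rewrite !size_cat !addnS //.
  by rewrite scaler0 addr0.
apply/eqP => /(congr1 (plift (fun s => (size s == 0)%:R : k^o))).
rewrite plift_gen // plift0 // => /eqP; by rewrite oner_eq0.
Qed.

(** The functionals are permuted while the vectors stay in order, so that the six terms match those
    of [sharp_br_alt]. *)
Definition det3 xi eta zeta (x y z : g) : k :=
  xi x * eta y * zeta z + eta x * zeta y * xi z + zeta x * xi y * eta z
  - xi x * zeta y * eta z - eta x * xi y * zeta z - zeta x * eta y * xi z.

Lemma contraction3_wedge xi eta zeta x y z :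
  contraction zeta (contraction eta (contraction xi (wedge [:: x; y; z]))) =
  det3 xi eta zeta x y z *: wedge [::].
Proof.
have E0 H : alt_expand (W := ext g) H [::] = 0 by rewrite /alt_expand big_ord0.
have C1 f u : contraction f (wedge [:: u]) = (f u : k) *: wedge [::].
  by rewrite contraction_wedge /contraction_list !alt_expand_cons E0 subr0.
have C2 f u v : contraction f (wedge [:: u; v]) =
    (f u : k) *: wedge [:: v] - (f v : k) *: wedge [:: u].
  by rewrite contraction_wedge /contraction_list !alt_expand_cons E0 subr0.
have C3 f u v w : contraction f (wedge [:: u; v; w]) =
    (f u : k) *: wedge [:: v; w] - (f v : k) *: wedge [:: u; w]
    + (f w : k) *: wedge [:: u; v].
  rewrite contraction_wedge /contraction_list !alt_expand_cons E0.
  by rewrite subr0 opprB addrA addrAC.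
have F2 (F : {linear ext g -> ext g}) a b u v :
    F (a *: u - b *: v) = a *: F u - b *: F v.
  by rewrite linearB !linearZ.
have F3 (F : {linear ext g -> ext g}) a b c u v w :
    F (a *: u - b *: v + c *: w) = a *: F u - b *: F v + c *: F w.
  by rewrite linearD linearB !linearZ.
rewrite C3 F3 /= !C2 F3 /= !(F2 (contraction zeta)) /= !C1.
have -> : det3 xi eta zeta x y z =
    xi x * (eta y * zeta z - eta z * zeta y)
    - xi y * (eta x * zeta z - eta z * zeta x)
    + xi z * (eta x * zeta y - eta y * zeta x) by rewrite /det3; ring.
by rewrite scalerDl scalerBl -!scalerA !scalerBl -!scalerA.
Qed.

End Contraction.

(** * The bracket of bivectors expressed through their sharp maps *)

Section SharpBracket.
Variables (k : fieldType) (g : lmodType k) (L : hom_lie g).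
Implicit Types (xi eta zeta : dual g) (chi omega : ext g).

Lemma linear_map0 (U V : lmodType k) (f : U -> V) : linear f -> f 0 = 0.
Proof. by move=> /(_ (-1) 0 0); rewrite scaler0 addr0 scaleN1r addNr. Qed.

Lemma sharp_linearl eta : linear (fun chi : ext g => sharp chi eta).
Proof.
move=> a u w; rewrite /sharp linearP.
exact: plift_linear (@sharp_respects _ _ eta) a _ _.
Qed.

Lemma sharp_wedge eta x y :
  sharp (wedge [:: x; y]) eta = (eta y : k) *: x - (eta x : k) *: y.
Proof.
rewrite /sharp ext_tens_wedge -[- tensor y x]scaleN1r [in LHS]addrC.
rewrite (plift_linear (@sharp_respects _ _ eta)) !plift_gen //=;
  try exact: sharp_respects.
by rewrite scaleN1r addrC.
Qed.

Lemma br_wedge2 x1 x2 y1 y2 : br_wedge L [:: x1; x2] [:: y1; y2] =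
  wedge [:: br L x1 y1; alpha L x2; alpha L y2]
  - wedge [:: br L x1 y2; alpha L x2; alpha L y1]
  - wedge [:: br L x2 y1; alpha L x1; alpha L y2]
  + wedge [:: br L x2 y2; alpha L x1; alpha L y1].
Proof.
rewrite /br_wedge !big_ord_recl !big_ord0 /= /bump /= !addr0 !addn0 !add0n.
by rewrite expr0 expr1 sqrrN expr1n !scale1r !scaleN1r addrA.
Qed.

Lemma in_ext_hbr chi omega :
  in_ext 2 chi -> in_ext 2 omega -> in_ext 3 (hbr L chi omega).
Proof.
move=> hchi homega; apply: (hchi (fun c => in_ext 3 (hbr L c omega))).
- by rewrite (linear_map0 (hbr_linearl L omega)); apply: in_span0.
- by move=> a u w hu hw; rewrite hbr_linearl; apply: in_spanP.
move=> _ [[|x1 [|x2 []]] // _ ->].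
apply: (homega (fun w => in_ext 3 (hbr L _ w))).
- by rewrite (linear_map0 (hbr_linearr L _)); apply: in_span0.
- by move=> a u w hu hw; rewrite hbr_linearr; apply: in_spanP.
move=> _ [[|y1 [|y2 []]] // _ ->].
have in3 x y z : in_ext 3 (wedge [:: x; y; z] : ext g).
  by apply: in_span_gen; exists [:: x; y; z].
have addZ a (u v : ext g) : in_ext 3 u -> in_ext 3 v -> in_ext 3 (u + a *: v).
  by move=> hu hv; rewrite addrC; exact: in_spanP.
rewrite hbr_wedge br_wedge2 -!scaleN1r -[X in _ + X]scale1r.
by do 3!apply: (addZ) => //.
Qed.

(* The terms of [chi, omega]_g whose bracket is paired with xi; alpha^* appears
   because [.,.]_g applies alpha to the remaining factors. *)
Definition sharp_br chi omega xi eta zeta : k :=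
  xi (br L (sharp chi (transpose (alpha L) eta))
           (sharp omega (transpose (alpha L) zeta))).

Lemma sharp_br_linearl omega xi eta zeta (a : k) u w :
  sharp_br (a *: u + w) omega xi eta zeta =
  a * sharp_br u omega xi eta zeta + sharp_br w omega xi eta zeta.
Proof. by rewrite /sharp_br sharp_linearl br_linearl dualP. Qed.

Lemma sharp_br_linearr chi xi eta zeta (a : k) u w :
  sharp_br chi (a *: u + w) xi eta zeta =
  a * sharp_br chi u xi eta zeta + sharp_br chi w xi eta zeta.
Proof. by rewrite /sharp_br sharp_linearl br_linearr dualP. Qed.

(** Antisymmetrization over the three functionals: the pairing of [hbr L chi omega] with xi /\ eta
    /\ zeta, by [contraction3_hbr]. *)
Definition sharp_br_alt chi omega xi eta zeta : k :=
  sharp_br chi omega xi eta zeta + sharp_br chi omega eta zeta xi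
  + sharp_br chi omega zeta xi eta - sharp_br chi omega xi zeta eta
  - sharp_br chi omega eta xi zeta - sharp_br chi omega zeta eta xi.

Lemma sharp_br_wedge xi eta zeta x1 x2 y1 y2 :
  sharp_br (wedge [:: x1; x2]) (wedge [:: y1; y2]) xi eta zeta =
  eta (alpha L x2) * zeta (alpha L y2) * xi (br L x1 y1)
  - eta (alpha L x2) * zeta (alpha L y1) * xi (br L x1 y2)
  - eta (alpha L x1) * zeta (alpha L y2) * xi (br L x2 y1)
  + eta (alpha L x1) * zeta (alpha L y1) * xi (br L x2 y2).
Proof.
rewrite /sharp_br !sharp_wedge !transposeE.
(* This shape lets the linearity laws, stated for [a *: u + v], apply to both summands. *)
have E (a b : k) (u v : g) : a *: u - b *: v = a *: u + (- b *: v + 0).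
  by rewrite addr0 scaleNr.
rewrite !E !br_linearl !br_linearr.
rewrite !(linear_map0 (br_linearr L _)) !(linear_map0 (br_linearl L _)) !addr0.
by rewrite !(dualP, linearZ, linear0) /= /GRing.scale /=; ring.
Qed.

(** Both sides are bilinear in [chi] and [omega], so decomposable bivectors suffice. There each of
    the four terms of [br_wedge2] contributes one [det3]. *)
Lemma contraction3_hbr chi omega xi eta zeta :
  in_ext 2 chi -> in_ext 2 omega ->
  contraction zeta (contraction eta (contraction xi (hbr L chi omega))) =
  sharp_br_alt chi omega xi eta zeta *: wedge [::].
Proof.
move=> hchi homega.
pose C : {linear ext g -> ext g} :=
  contraction zeta \o (contraction eta \o contraction xi).
pose S c w := C (hbr L c w) = sharp_br_alt c w xi eta zeta *: wedge [::].
have altl w : linear (fun c => sharp_br_alt c w xi eta zeta : k^o).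
  by move=> a u v; rewrite /sharp_br_alt !sharp_br_linearl /GRing.scale /=; ring.
have altr c : linear (fun w => sharp_br_alt c w xi eta zeta : k^o).
  by move=> a u v; rewrite /sharp_br_alt !sharp_br_linearr /GRing.scale /=; ring.
rewrite -[LHS]/(C _).
apply: (hchi (S^~ omega)) => [|a u w hu hw|_ [[|x1 [|x2 []]] // _ ->]].
- rewrite /S (linear_map0 (hbr_linearl L omega)) (linear_map0 (altl omega)).
  by rewrite linear0 scale0r.
- rewrite /S hbr_linearl altl scalerDl -scalerA -hu -hw.
  exact: (linearP C).
apply: (homega (S _)) => [|a u w hu hw|_ [[|y1 [|y2 []]] // _ ->]].
- rewrite /S (linear_map0 (hbr_linearr L _)) (linear_map0 (altr _)).
  by rewrite linear0 scale0r.
- rewrite /S hbr_linearr altr scalerDl -scalerA -hu -hw.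
  exact: (linearP C).
rewrite /S hbr_wedge br_wedge2 linearD !linearB /C /= !contraction3_wedge.
rewrite -!scalerBl -!scalerDl; congr (_ *: _).
by rewrite /sharp_br_alt !sharp_br_wedge /det3; ring.
Qed.

Lemma tens_pair_ext_tens_skew chi xi eta : in_ext 2 chi ->
  tens_pair xi eta (ext_tens chi) = - tens_pair eta xi (ext_tens chi).
Proof.
move=> hchi; rewrite -!sharpP.
apply: (hchi (fun c => xi (sharp c eta) = - eta (sharp c xi))).
- by rewrite !(linear_map0 (sharp_linearl _)) !linear0.
- by move=> a u w hu hw; rewrite !sharp_linearl !dualP hu hw opprD mulrN.
move=> _ [[|x [|y []]] // _ ->]; rewrite !sharp_wedge !linearB !linearZ /=.
by rewrite /GRing.scale /=; ring.
Qed.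

Lemma sharp_skew chi xi eta : in_ext 2 chi ->
  xi (sharp chi eta) = - eta (sharp chi xi).
Proof. by move=> hchi; rewrite !sharpP tens_pair_ext_tens_skew. Qed.

(** For [talpha]-fixed [chi] this is what makes [sharp chi] intertwine the inverse transpose of
    [alpha] with [alpha]. *)
Lemma sharp_talpha chi eta : in_ext 2 chi ->
  sharp (talpha L chi) eta = alpha L (sharp chi (transpose (alpha L) eta)).
Proof.
move=> hchi; apply: (hchi (fun c => sharp (talpha L c) eta =
  alpha L (sharp c (transpose (alpha L) eta)))).
- by rewrite linear0 !(linear_map0 (sharp_linearl _)) linear0.
- by move=> a u w hu hw; rewrite linearP !sharp_linearl linearP hu hw.
move=> _ [[|x [|y []]] // _ ->].
by rewrite talpha_wedge !sharp_wedge !transposeE linearB !linearZ.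
Qed.

Lemma sharp_br_swap chi xi eta zeta :
  sharp_br chi chi xi zeta eta = - sharp_br chi chi xi eta zeta.
Proof. by rewrite /sharp_br br_skew linearN. Qed.

End SharpBracket.

(** * O-operators for the coadjoint representation *)

Section CoadjointOperator.
Variables (k : fieldType) (char0 : [pchar k] =i pred0).
Variables (g : lmodType k) (L : reg_hom_lie g).
Implicit Types (chi : ext g) (xi eta zeta : dual g).

Lemma sharp_transpose_alpha chi eta : invariant_ext L 2 chi ->
  alpha L (sharp chi (transpose (alpha L) eta)) = sharp chi eta.
Proof. by case=> hchi inv; rewrite -sharp_talpha // inv. Qed.

(** Skewness moves [xi] into the bracket of [coad]. The [alpha] on [zeta] cancels one [alphaV] in
    each argument, and invariance absorbs the [alphaV] left on [sharp chi xi]. *)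
Lemma sharp_coad chi xi eta zeta : invariant_ext L 2 chi ->
  xi (sharp chi (coad L (sharp chi (transpose (alpha L) eta))
                        (transpose (alpha L) zeta))) =
  sharp_br L chi chi zeta eta xi.
Proof.
move=> hchi; rewrite sharp_skew; last by case: hchi.
rewrite coadE opprK transposeE alpha_br !alphaVK.
by rewrite -(sharp_transpose_alpha xi hchi) alphaK.
Qed.

Lemma o_operator_sharpP chi : invariant_ext L 2 chi ->
  o_operator (coadjoint L) (sharp chi) <-> hbr L chi chi = 0.
Proof.
move=> hchi; have [chi2 _] := hchi.
pose B := sharp_br L chi chi.
(* The right side of the O-operator equation at [u], [v], paired with [xi]; the left side is
   [B xi eta zeta], so the equation says that the cyclic sum of [B] vanishes. *)
have defect xi eta zeta (u := transpose (alpha L) eta) (v := transpose (alpha L) zeta) :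
    xi (sharp chi (coad L (sharp chi u) v - coad L (sharp chi v) u)) =
    - (B eta zeta xi + B zeta xi eta).
  rewrite !linearB /= !sharp_coad // [B zeta xi eta]sharp_br_swap.
  by rewrite /B opprD opprK addrC.
have altE xi eta zeta : sharp_br_alt L chi chi xi eta zeta =
    2%:R * (B xi eta zeta + B eta zeta xi + B zeta xi eta).
  rewrite /sharp_br_alt (sharp_br_swap L chi xi eta zeta).
  rewrite (sharp_br_swap L chi eta zeta xi) (sharp_br_swap L chi zeta xi eta).
  by rewrite -/(B _ _ _) /B; ring.
split=> [[_ hO]|hbr0].
  have h3 := in_ext_hbr L chi2 chi2.
  suff h xi eta zeta :
      contraction zeta (contraction eta (contraction xi (hbr L chi chi))) = 0.
    (* Three contractions descend from degree 3 to degree 0. *)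
    apply: (ext_contraction_eq0 char0 h3) => xi.
    apply: (ext_contraction_eq0 char0 (in_ext_contraction _ h3)) => eta.
    apply: (ext_contraction_eq0 char0
      (in_ext_contraction _ (in_ext_contraction _ h3))) => zeta.
    exact: h.
  rewrite contraction3_hbr // altE.
  have := congr1 (dual_fun xi) (hO (transpose (alpha L) eta) (transpose (alpha L) zeta)).
  rewrite defect -/(sharp_br L chi chi xi eta zeta) -/(B _ _ _) => ->.
  by rewrite -addrA addNr mulr0 scale0r.
split=> [v|u v].
  transitivity (sharp chi (transpose (alphaV L) v)) => //.
  by rewrite -[LHS](sharp_transpose_alpha _ hchi) transposeK.
apply: dual_separates => xi.
(* Every functional is a transpose by [alpha], since [alpha] is invertible; this brings the equation
   to the form of [defect]. *)
have [eta ->] : exists eta, u = transpose (alpha L) eta.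
  by exists (transpose (alphaV L) u); rewrite transposeK.
have [zeta ->] : exists zeta, v = transpose (alpha L) zeta.
  by exists (transpose (alphaV L) v); rewrite transposeK.
rewrite defect -/(sharp_br L chi chi xi eta zeta) -/(B _ _ _).
have := contraction3_hbr L xi eta zeta chi2 chi2.
rewrite hbr0 (linear0 (contraction xi)) (linear0 (contraction eta)).
rewrite (linear0 (contraction zeta)) altE => /esym/eqP; rewrite scaler_eq0.
rewrite (negbTE (wedge_nil_neq0 g)) orbF mulf_eq0.
have -> : (2%:R == 0 :> k) = false by move/pcharf0P: char0 => ->.
by rewrite /= -addrA addr_eq0 => /eqP.
Qed.

(** * Correspondence of linear deformations *)

Lemma o_operator_eq (V : lmodType k) (P : hom_rep L V) (T1 T2 : {linear V -> g}) :
  T1 =1 T2 -> o_operator P T1 <-> o_operator P T2.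
Proof.
by move=> h; split=> -[hT hbr]; split=> *; rewrite ?h ?hT ?hbr -?h // ?hT ?hbr.
Qed.

Lemma invariant_extD n (a : k) (u w : ext g) :
  invariant_ext L n u -> invariant_ext L n w -> invariant_ext L n (w + a *: u).
Proof.
move=> [hu iu] [hw iw]; split; last by rewrite linearD linearZ /= iu iw.
by rewrite addrC; apply: in_spanP.
Qed.

Lemma generates_deformation_sharpP (r tau : ext g) :
  invariant_ext L 2 r -> invariant_ext L 2 tau ->
  generates_r_deformation L r tau <->
  generates_o_deformation (coadjoint L) (sharp r) (sharp tau).
Proof.
move=> hr htau.
have inv t := invariant_extD t htau hr.
(* The two sides are separately bundled linear maps, hence the pointwise equality and
   [o_operator_eq]. *)
have sharpE t : sharp (r + t *: tau) =1 (sharp r \+ t \*: sharp tau).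
  by move=> eta; rewrite addrC sharp_linearl addrC.
split=> [[_ hdef]|[_ hdef]].
  split=> [v|t].
    transitivity (sharp tau (transpose (alphaV L) v)) => //.
    by rewrite -[LHS](sharp_transpose_alpha _ htau) transposeK.
  apply/(o_operator_eq _ (sharpE t)); apply/o_operator_sharpP => //.
  by case: (hdef t).
split=> // t; split=> //; apply/o_operator_sharpP => //.
by apply/(o_operator_eq _ (sharpE t)); apply: hdef.
Qed.

(** * Correspondence of equivalences *)

Lemma phi_V_coadjoint t x xi :
  phi_V (coadjoint L) t x xi = transpose (psi_g L t x) xi.
Proof.
apply: dual_ext => y; rewrite /phi_V addrC dualPE transposeE.
(* The inverse of [beta] is the transpose of [alpha]; it cancels one of the two [alphaV] on the
   second argument of the bracket, leaving minus [xi] at [ad_dagger L x y]. *)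
rewrite -[betaV _ _]/(transpose (alpha L) (coad L x xi)) transposeE coadE.
rewrite alphaK -alphaV_br -[psi_g L t x y]/(y - t *: ad_dagger L x y).
by rewrite linearB linearZ /= mulrN addrC.
Qed.

Lemma tens_pair_map xi eta (f h : {linear g -> g}) (s : tens g) :
  tens_pair xi eta (tens_map f h s) =
  tens_pair (transpose f xi) (transpose h eta) s.
Proof.
move: s; apply: pres_ind => [|a s u hs hu|[x y]].
- by rewrite linear0 /tens_pair !plift0 //; apply: tens_pair_respects.
- by rewrite linearP !tens_pair_linear hs hu.
by rewrite -/(tensor x y) tens_mapE !tens_pair_tensor !transposeE.
Qed.

Lemma transpose_idfun (xi : dual g) : transpose idfun xi = xi.
Proof. exact: dual_ext. Qed.

(** Pair both tensors with arbitrary functionals; skewness of [r1] and [r2] puts the same functional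
    outermost on both sides, and separation of points removes it. *)
Lemma tens_map_sharpP (r1 r2 : ext g) (phi psi : {linear g -> g}) :
  in_ext 2 r1 -> in_ext 2 r2 ->
  tens_map psi idfun (ext_tens r2) = tens_map idfun phi (ext_tens r1) <->
  (forall eta, sharp r2 (transpose psi eta) = phi (sharp r1 eta)).
Proof.
move=> h1 h2.
have E2 xi eta : tens_pair xi eta (tens_map psi idfun (ext_tens r2)) =
    - eta (sharp r2 (transpose psi xi)).
  by rewrite tens_pair_map transpose_idfun -sharpP sharp_skew.
have E1 xi eta : tens_pair xi eta (tens_map idfun phi (ext_tens r1)) =
    - eta (phi (sharp r1 xi)).
  by rewrite tens_pair_map transpose_idfun -sharpP sharp_skew.
split=> [eq_tens xi|eq_sharp].
  by apply: dual_separates => eta; apply: oppr_inj; rewrite -E2 -E1 eq_tens.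
by apply: tens_pair_separates => xi eta; rewrite E2 E1 eq_sharp.
Qed.

Lemma coad_intertwineP (phi psi : {linear g -> g}) :
  (forall y, phi (alphaV L y) = alphaV L (phi y)) ->
  (forall y, psi (alphaV L y) = alphaV L (psi y)) ->
  (forall y z, psi (br L (phi y) z) = br L y (psi z)) <->
  (forall y xi, transpose psi (coad L y xi) = coad L (phi y) (transpose psi xi)).
Proof.
move=> phiV psiV; split=> [h y xi|h y z].
  by apply: dual_ext => z; rewrite !(transposeE, coadE) -phiV h !psiV.
apply: dual_separates => xi; apply: oppr_inj.
(* The arguments [alpha L y] and [alpha L (alpha L z)] cancel the inverses in [coad]. *)
have := congr1 (fun f : dual g => f (alpha L (alpha L z))) (h (alpha L y) xi).
by rewrite !(transposeE, coadE) -phiV -!psiV !alphaK.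
Qed.

(** The same [x] serves both sides, and for each [t] the conditions correspond one by one through
    [phi_V_coadjoint]. *)
Lemma deformations_equivalent_sharpP (r1 r2 : k -> ext g) :
  (forall t, in_ext 2 (r1 t)) -> (forall t, in_ext 2 (r2 t)) ->
  r_deformations_equivalent L r1 r2 <->
  o_deformations_equivalent (coadjoint L)
    (fun t => sharp (r1 t)) (fun t => sharp (r2 t)).
Proof.
move=> h1 h2.
have commV (f : {linear g -> g}) : (forall y, f (alpha L y) = alpha L (f y)) ->
    forall y, f (alphaV L y) = alphaV L (f y).
  by move=> fa y; rewrite -[in RHS](alphaVK L y) fa alphaK.
split=> -[x [ax h]]; exists x; split=> // t; have [hphi hA hB hC] := h t.
  have phiV := commV _ hphi.2; have psiV := commV _ hA.
  split=> // [v|v|y v]; rewrite !phi_V_coadjoint.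
  - by apply: (tens_map_sharpP _ _ (h1 t) (h2 t)).1.
  - by apply: dual_ext => y; apply: (congr1 (dual_fun v) (esym (psiV y))).
  - by apply: (coad_intertwineP phiV psiV).1.
(* Commutation of [phi_V] with [beta], tested on all functionals, gives commutation of [psi_g] with
   [alphaV], whence with [alpha]. *)
have psiV y : psi_g L t x (alphaV L y) = alphaV L (psi_g L t x y).
  apply: dual_separates => xi; have := hB xi; rewrite !phi_V_coadjoint.
  by move=> /(congr1 (fun f : dual g => f y)) /esym.
have phiV := commV _ hphi.2.
split=> // [y||].
- by apply: (can_inj (alphaVK L)); rewrite -psiV !alphaK.
- by apply/(tens_map_sharpP _ _ (h1 t) (h2 t)) => eta; rewrite -phi_V_coadjoint hA.
- apply/(coad_intertwineP phiV psiV) => y xi.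
  by rewrite -!phi_V_coadjoint hC.
Qed.

End CoadjointOperator.

Theorem proposition5p13 (k : fieldType) (char0 : [pchar k] =i pred0)
    (g : lmodType k) (L : reg_hom_lie g)
    (r : ext g) (hr : skew_rmatrix L r) :
  (forall tau : ext g, invariant_ext L 2 tau ->
     (generates_r_deformation L r tau <->
      generates_o_deformation (coadjoint L) (sharp r) (sharp tau)))
  /\
  (forall tau1 tau2 : ext g,
     generates_r_deformation L r tau1 ->
     generates_r_deformation L r tau2 ->
     (r_deformations_equivalent L
        (fun t => r + t *: tau1) (fun t => r + t *: tau2) <->
      o_deformations_equivalent (coadjoint L)
        (fun t => sharp (r + t *: tau1)) (fun t => sharp (r + t *: tau2)))).
Proof.
have [inv_r _] := hr.
split=> [tau inv_tau|tau1 tau2 [inv1 _] [inv2 _]].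
  exact: generates_deformation_sharpP.
by apply: deformations_equivalent_sharpP => t;
  [case: (invariant_extD t inv1 inv_r)|case: (invariant_extD t inv2 inv_r)].
Qed.
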